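(* Let $\nu(dx)=\nu(|x|)\,dx$ be an infinite isotropic unimodal Lévy measure on $\mathbb R^d$, that is, $(0,\infty)\ni r\mapsto\nu(r)$ is nonincreasing, $\nu(\mathbb R^d\setminus\{0\})=\infty$ and $\int_{\mathbb R^d\setminus\{0\}}(|x|^2\wedge1)\,\nu(dx)<\infty$. Let $$\psi(\xi)=\int_{\mathbb R^d}(1-\cos\langle\xi,x\rangle)\,\nu(dx),\qquad \xi\in\mathbb R^d,$$ and write $\psi(r)=\psi(\xi)$ for $r=|\xi|$. Let $0<\underline\alpha\le\overline\alpha<2$ and assume that $0\not\equiv\psi\in\mathrm{WLSC}(\underline\alpha,\underline c)\cap\mathrm{WUSC}(\overline\alpha,\overline c)$. Let $$\mathcal E(u,u)=\frac12\int_{\mathbb R^d}\int_{\mathbb R^d}(u(x)-u(y))^2\,\nu(|y-x|)\,dy\,dx .$$ If $d>\overline\alpha$, then there is $c>0$ such that for all $u\in L^2(\mathbb R^d)$, $$\mathcal E(u,u)\ge c\int_{\mathbb R^d}u(x)^2\,\psi(1/|x|)\,dx.$$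
   Context: For $\varphi:[0,\infty)\to[0,\infty)$: $\varphi\in\mathrm{WLSC}(\underline\alpha,\underline c)$ (with $\underline c\in(0,1]$) means $\varphi(\lambda\theta)\ge\underline c\,\lambda^{\underline\alpha}\varphi(\theta)$ for all $\lambda\ge1$, $\theta>0$; $\varphi\in\mathrm{WUSC}(\overline\alpha,\overline c)$ (with $\overline c\in[1,\infty)$) means $\varphi(\lambda\theta)\le\overline c\,\lambda^{\overline\alpha}\varphi(\theta)$ for all $\lambda\ge1$, $\theta>0$. The function $\psi$ is radial, so $\psi(r)$ is well defined, and the scaling conditions refer to $r\mapsto\psi(r)$ on $[0,\infty)$. *)

(* Defs.v *)
From HB Require Import structures.
From mathcomp Require Import all_boot all_order all_algebra.
From mathcomp Require Import all_classical all_reals all_analysis.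
Set Implicit Arguments.
Unset Strict Implicit.
Unset Printing Implicit Defensive.
Import Order.TTheory GRing.Theory Num.Theory.
Import numFieldNormedType.Exports.
Local Open Scope classical_set_scope.
Local Open Scope ring_scope.

Section lebesgue_measure_cons.
Context {R : realType} {d : nat}.
Variable mu : {sigma_finite_measure set (d.-tuple R) -> \bar R}.
Local Open Scope ereal_scope.

Definition tuple_cons (p : measurableTypeR R * d.-tuple R) : d.+1.-tuple R :=
  [tuple of p.1 :: p.2].

Lemma measurable_tuple_cons : measurable_fun setT tuple_cons.
Proof.
apply: (@measurable_cons _ _ _ R (fun p => p.1) d (fun p => p.2)).
- exact: (@measurable_fst _ _ (measurableTypeR R) (d.-tuple R)).
- exact: measurable_snd.
Qed.

Definition lebesgue_cons : set (d.+1.-tuple R) -> \bar R :=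
  pushforward (@lebesgue_measure R \x mu) tuple_cons.

Let lebesgue_cons_preim (A : set (d.+1.-tuple R)) :
  measurable A -> measurable (tuple_cons @^-1` A).
Proof.
by move=> mA; rewrite -[X in measurable X]setTI; exact: measurable_tuple_cons.
Qed.

Let lebesgue_cons0 : lebesgue_cons set0 = 0.
Proof. by rewrite /lebesgue_cons /pushforward preimage_set0 measure0. Qed.

Let lebesgue_cons_ge0 A : 0 <= lebesgue_cons A.
Proof. by rewrite /lebesgue_cons /pushforward measure_ge0. Qed.

Let lebesgue_cons_sigma_additive : semi_sigma_additive lebesgue_cons.
Proof.
move=> F mF tF mUF; rewrite /lebesgue_cons /pushforward preimage_bigcup.
apply: measure_semi_sigma_additive.
- by move=> n; exact: lebesgue_cons_preim.
- apply/trivIsetP => /= i j _ _ ij; rewrite -preimage_setI.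
  by move/trivIsetP : tF => /(_ _ _ _ _ ij) ->//; rewrite preimage_set0.
- by rewrite -preimage_bigcup; exact: lebesgue_cons_preim.
Qed.

HB.instance Definition _ := isMeasure.Build _ _ _ lebesgue_cons
  lebesgue_cons0 lebesgue_cons_ge0 lebesgue_cons_sigma_additive.

Let uncons (t : d.+1.-tuple R) : measurableTypeR R * d.-tuple R :=
  (thead t, [tuple of behead t]).

Let measurable_uncons : measurable_fun setT uncons.
Proof.
apply: measurable_fun_pair; last exact: measurable_behead.
exact: (@measurable_tnth _ R _ ord0).
Qed.

Let tuple_consK : cancel tuple_cons uncons.
Proof. by move=> [x t]; congr pair; exact/val_inj. Qed.

Let lebesgue_cons_sigma_finite : sigma_finite setT lebesgue_cons.
Proof.
have /sigma_finiteP[F [TF ndF Foo]] := sigma_finiteT (@lebesgue_measure R).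
have /sigma_finiteP[G [TG ndG Goo]] := sigma_finiteT mu.
exists (fun n => uncons @^-1` (F n `*` G n)) => [|n].
  apply/seteqP; split => // t _.
  have [k _ Fk] : (\bigcup_k F k) (uncons t).1 by rewrite -TF.
  have [l _ Gl] : (\bigcup_l G l) (uncons t).2 by rewrite -TG.
  exists (maxn k l) => //; split.
  - by move: Fk; exact/subsetPset/ndF/leq_maxl.
  - by move: Gl; exact/subsetPset/ndG/leq_maxr.
have [mF Fn] := Foo n; have [mG Gn] := Goo n; split.
  by rewrite -[X in measurable X]setTI; apply: measurable_uncons => //;
    exact: measurableX.
rewrite /lebesgue_cons /pushforward -comp_preimage.
rewrite (_ : uncons \o tuple_cons = id); last first.
  by apply/funext => p /=; rewrite tuple_consK.
by rewrite preimage_id product_measure1E// lte_mul_pinfty// ge0_fin_numE.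
Qed.

HB.instance Definition _ := Measure_isSigmaFinite.Build _ _ _ lebesgue_cons
  lebesgue_cons_sigma_finite.

End lebesgue_measure_cons.

(* Lebesgue measure on R^d, the points of which are the d-tuples of reals with
   their product (Borel) sigma-algebra.  In dimension 0 it is the unit mass; in
   dimension d.+1 it is the product of the one- and d-dimensional ones. *)
Fixpoint lebesgue (R : realType) (d : nat) :
    {sigma_finite_measure set (d.-tuple R) -> \bar R} :=
  match d with
  | 0 => \d_([tuple] : 0.-tuple R)
  | d'.+1 => lebesgue_cons (lebesgue R d')
  end.

Lemma lebesgue_box (R : realType) (d : nat) (A : 'I_d -> set R) :
  (forall i, measurable (A i)) ->
  lebesgue R d [set x | forall i, A i (tnth x i)] =
  (\prod_(i < d) @lebesgue_measure R (A i))%E.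
Proof.
elim: d A => [|d IHd] A mA.
  by rewrite big_ord0 /= diracE mem_set// => -[].
rewrite big_ord_recl /= /lebesgue_cons /pushforward.
rewrite (_ : _ @^-1` _ =
    A ord0 `*` [set x | forall i, A (lift ord0 i) (tnth x i)]); last first.
  apply/seteqP; split=> -[r t] /=.
    move=> At; split; first exact: (At ord0).
    by move=> i; have := At (lift ord0 i); rewrite tnthS.
  move=> [Ar At] i; case: (unliftP ord0 i) => [j ->|->] //.
  by rewrite tnthS; exact: At.
have mB : measurable [set x : d.-tuple R | forall i, A (lift ord0 i) (tnth x i)].
  rewrite (_ : [set x | _] =
      \bigcap_(i in [set: 'I_d]) ((@tnth d R ^~ i) @^-1` A (lift ord0 i))).
    apply: fin_bigcap_measurable => // i _.
    by rewrite -[X in measurable X]setTI; apply: measurable_tnth.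
  apply/seteqP; split=> x /= Ax i; first by move=> _; exact: Ax.
  exact: (Ax i I).
rewrite product_measure1E//; last exact: mA.
by rewrite (IHd (fun i => A (lift ord0 i))).
Qed.

Section euclidean.
Context {R : realType} {d : nat}.
Implicit Types x y : d.-tuple R.

Definition dotp x y : R := \sum_(i < d) tnth x i * tnth y i.

Definition enorm x : R := Num.sqrt (dotp x x).

Definition tuple_sub x y : d.-tuple R := [tuple tnth x i - tnth y i | i < d].

Definition origin : d.-tuple R := [tuple 0 | i < d].

(* The point (r, 0, ..., 0), whose Euclidean norm is `|r| when 0 < d. *)
Definition axis_point (r : R) : d.-tuple R :=
  [tuple if i == 0%N :> nat then r else 0 | i < d].

(* The profile r |-> f xi, r = |xi|, of a radial function f; only its values
   at r >= 0 are meaningful. *)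
Definition radial_profile (f : d.-tuple R -> R) (r : R) : R := f (axis_point r).

End euclidean.

Section scaling.
Context {R : realType}.
Implicit Types (phi : R -> R) (alpha c : R).

Definition WLSC alpha c phi : Prop := forall lambda theta : R,
  1 <= lambda -> 0 < theta ->
  c * lambda `^ alpha * phi theta <= phi (lambda * theta).

Definition WUSC alpha c phi : Prop := forall lambda theta : R,
  1 <= lambda -> 0 < theta ->
  phi (lambda * theta) <= c * lambda `^ alpha * phi theta.

End scaling.

Section levy.
Context {R : realType} (d : nat).

(* [nu : R -> R] is the radial density of the measure nu(|x|) dx on R^d minus
   the origin; only its values on the positive half-line matter.  It can be
   taken real-valued: being nonincreasing, a profile infinite at some r > 0
   would be infinite on the whole of ]0, r], against the integrability. *)
Definition isotropic_unimodal_levy (nu : R -> R) : Prop :=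
  [/\ forall r : R, 0 < r -> 0 <= nu r,
      forall r s : R, 0 < r -> r <= s -> nu s <= nu r &
      (\int[lebesgue R d]_(x in ~` [set origin])
        (Num.min (enorm x ^+ 2) 1 * nu (enorm x))%:E < +oo)%E].

Definition infinite_levy (nu : R -> R) : Prop :=
  (\int[lebesgue R d]_(x in ~` [set origin]) (nu (enorm x))%:E = +oo)%E.

(* The integral is finite under [isotropic_unimodal_levy]. *)
Definition levy_symbol (nu : R -> R) (xi : d.-tuple R) : R :=
  \int[lebesgue R d]_x ((1 - cos (dotp xi x)) * nu (enorm x)).

Definition dirichlet_form (nu : R -> R) (u : d.-tuple R -> R) : \bar R :=
  ((2^-1)%:E * \int[lebesgue R d]_x \int[lebesgue R d]_y
    ((u x - u y) ^+ 2 * nu (enorm (tuple_sub y x)))%:E)%E.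

End levy.

(* Main.v *)
(* Proof. Let phi(r) = psi(1/r). Lower scaling bounds the nu-mass of
   {|x_i| >= r} by C phi(r): sum 1 - cos over the dyadic frequencies 2^-j / r.
   Splitting the integral psi(1/r) at |x_0| = r/M and at |x_i| = M r, the two
   outer parts are at most M^(aup-2) and M^-alow times a multiple of phi(r), so
   for large M the middle one dominates, and monotonicity of nu yields
   nu(r) >= c phi(r) r^-d.
   For Hardy's inequality, cut space into the cubical shells
   D_n = {s M^n <= |x|_oo < s M^(n+1)} and average
   u(x)^2 <= 2 (u(x) - u(y))^2 + 2 u(y)^2 over x in D_n and y in D_(n+1). With
   a_n = phi(s M^n) int_(D_n) u^2 and e_n the energy of jumps started in D_n,
   this reads a_n <= C e_n + 2 cup M^(aup-d) a_(n+1). As aup < d, the last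
   coefficient is at most 1/2 for large M; the sum of the a_n is finite because
   u is in L^2 and n >= 0, so the last term is absorbed, uniformly in s. Finally
   s tends to 0. *)
From HB Require Import structures.
Require Import Defs.
From mathcomp Require Import all_boot all_order all_algebra fingroup perm.
From mathcomp Require Import all_classical all_reals all_analysis.
From mathcomp Require Import measurable_realfun ring lra.
Import Order.TTheory GRing.Theory Num.Theory.
Import numFieldNormedType.Exports.
Local Open Scope classical_set_scope.
Local Open Scope ring_scope.

(** * Trigonometric bounds *)

Section trigonometric_bounds.
Context {R : realType}.
Implicit Types (f df : R -> R) (t : R).

(** The bounds below form a chain: the derivative of each difference is the preceding difference, so
    nonnegativity passes from [t - sin t] up to the fourth-order bound on [cos]. *)
Lemma ge0_of_derive_ge0 f df t : 0 <= f 0 ->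
  (forall x : R, is_derive x 1 f (df x)) -> (forall x, 0 <= x -> 0 <= df x) ->
  0 <= t -> 0 <= f t.
Proof.
move=> f0 fdf df0 t0; apply: (le_trans f0).
have dfE x : derivable f x 1 by have [] := fdf x.
apply: (@ger0_derive1_le_cc _ f 0 t) => //.
- by move=> x; rewrite in_itv/= => /andP[x0 _]; rewrite derive1E;
    have [_ ->] := fdf x; rewrite df0// ltW.
- apply: continuous_subspaceT => x; apply: differentiable_continuous.
  by apply/derivable1_diffP; exact: dfE.
- by rewrite in_itv/= lexx.
- by rewrite in_itv/= lexx t0.
Qed.

Lemma sin_le t : 0 <= t -> sin t <= t.
Proof.
move=> t0; rewrite -subr_ge0.
apply: (@ge0_of_derive_ge0 (fun x => x - sin x) (fun x => 1 - cos x)) => //=.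
by rewrite sin0 subr0.
Qed.

Lemma cos_ge t : 1 - t ^+ 2 / 2 <= cos t.
Proof.
wlog t0 : t / 0 <= t.
  move=> H; have [/H //|t0] := leP 0 t.
  by rewrite -cosN -sqrrN H// oppr_ge0 ltW.
rewrite -subr_ge0.
apply: (@ge0_of_derive_ge0 (fun x => cos x - (1 - x ^+ 2 / 2))
  (fun x => x - sin x)) => //.
- by rewrite cos0; lra.
- move=> x; apply: is_derive_eq; rewrite /GRing.scale /=; lra.
- by move=> x x0; rewrite subr_ge0 sin_le.
Qed.

Lemma sin_ge t : 0 <= t -> t - t ^+ 3 / 6 <= sin t.
Proof.
move=> t0; rewrite -subr_ge0.
apply: (@ge0_of_derive_ge0 (fun x => sin x - (x - x ^+ 3 / 6))
  (fun x => cos x - (1 - x ^+ 2 / 2))) => //.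
- by rewrite sin0; lra.
- move=> x; apply: is_derive_eq; rewrite /GRing.scale /=; lra.
- by move=> x x0; rewrite subr_ge0 cos_ge.
Qed.

Lemma cos_le t : cos t <= 1 - t ^+ 2 / 2 + t ^+ 4 / 24.
Proof.
wlog t0 : t / 0 <= t.
  move=> H; have [/H //|t0] := leP 0 t.
  rewrite -cosN -(sqrrN t) (_ : t ^+ 4 = (- t) ^+ 4); last by ring.
  by rewrite H// oppr_ge0 ltW.
rewrite -subr_ge0.
apply: (@ge0_of_derive_ge0 (fun x => 1 - x ^+ 2 / 2 + x ^+ 4 / 24 - cos x)
  (fun x => sin x - (x - x ^+ 3 / 6))) => //.
- by rewrite cos0; lra.
- move=> x; apply: is_derive_eq; rewrite /GRing.scale /=; lra.
- by move=> x x0; rewrite subr_ge0 sin_ge.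
Qed.

Lemma one_sub_cos_ge0 t : 0 <= 1 - cos t.
Proof. by rewrite subr_ge0 cos_le1. Qed.

Lemma one_sub_cos_le2 t : 1 - cos t <= 2.
Proof. by have := cos_geN1 t; lra. Qed.

Lemma one_sub_cos_le t : 1 - cos t <= t ^+ 2 / 2.
Proof. by have := cos_ge t; lra. Qed.

(** For t^2 <= 4 the quartic term t^4/24 is at most t^2/6, which leaves t^2/2 - t^2/6. *)
Lemma one_sub_cos_ge t : `|t| <= 2 -> t ^+ 2 / 3 <= 1 - cos t.
Proof.
move=> t2; have : t ^+ 2 <= 4.
  by rewrite -real_normK ?num_real// (_ : 4 = 2 ^+ 2) ?lerXn2r ?nnegrE//; lra.
have := cos_le t; have := sqr_ge0 t; rewrite (_ : t ^+ 4 = t ^+ 2 * t ^+ 2); last by ring.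
by nra.
Qed.

End trigonometric_bounds.

(** * Cubes and coordinate permutations *)

Section cubes.
Context {R : realType} {d : nat}.
Implicit Types (x y : d.-tuple R) (r s : R).

Definition cube r : set (d.-tuple R) := [set x | forall i, `|tnth x i| < r].

Lemma measurable_coordinates (A : 'I_d -> set R) :
  (forall i, measurable (A i)) ->
  measurable [set x : d.-tuple R | forall i, A i (tnth x i)].
Proof.
move=> mA; rewrite (_ : [set x | _] =
    \bigcap_(i in [set: 'I_d]) ((@tnth d R ^~ i) @^-1` A i)).
  apply: fin_bigcap_measurable => // i _.
  by rewrite -[X in measurable X]setTI; apply: measurable_tnth.
by apply/seteqP; split=> x /= Ax i; [move=> _; exact: Ax|exact: (Ax i I)].
Qed.

Lemma cubeE r : cube r = [set x | forall i, `]-r, r[%classic (tnth x i)].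
Proof.
apply/seteqP; split=> x /= xr i; have := xr i;
  by rewrite /= in_itv/= ltr_norml.
Qed.

Lemma measurable_cube r : measurable (cube r).
Proof. by rewrite cubeE; exact: (measurable_coordinates (fun=> `]-r, r[%classic)). Qed.

Lemma lebesgue_cube r : 0 <= r -> lebesgue R d (cube r) = ((2 * r) ^+ d)%:E.
Proof.
move=> r0; rewrite cubeE (@lebesgue_box R d (fun=> `]-r, r[%classic))//.
under eq_bigr do rewrite lebesgue_measure_itv/= lte_fin.
rewrite [X in (_ = X)%E](_ : _ = (\prod_(i < d) (2 * r)%:E)%E); last first.
  by rewrite prodEFin prodr_const card_ord.
apply: eq_bigr => i _; case: ifPn => [_|]; first by rewrite -EFinD; congr EFin; ring.
by rewrite -leNgt => r1; congr EFin; lra.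
Qed.

Lemma sub_cube r s : r <= s -> cube r `<=` cube s.
Proof. by move=> rs x xr i; exact: lt_le_trans (xr i) rs. Qed.

Lemma dotp_ge0 x : 0 <= dotp x x.
Proof. by apply: sumr_ge0 => i _; rewrite -expr2 sqr_ge0. Qed.

Lemma enorm_ge0 x : 0 <= enorm x.
Proof. exact: sqrtr_ge0. Qed.

Lemma sqr_enorm x : enorm x ^+ 2 = dotp x x.
Proof. by rewrite sqr_sqrtr ?dotp_ge0. Qed.

Lemma tnth_le_enorm x i : `|tnth x i| <= enorm x.
Proof.
rewrite -(@ler_pXn2r _ 2)// ?nnegrE ?enorm_ge0// sqr_enorm real_normK ?num_real//.
rewrite /dotp (bigD1 i)//= -expr2 lerDl; apply: sumr_ge0 => j _.
by rewrite -expr2 sqr_ge0.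
Qed.

Lemma enorm_le_cube r x : cube r x -> enorm x <= d%:R * r.
Proof.
(* In dimension 0 every [cube r] is the whole space, even for r < 0; otherwise a point of the cube
   forces r > 0. *)
case: (posnP d) => [d0 _|d0 xr].
  rewrite (_ : enorm x = 0) ?d0 ?mul0r//; apply/eqP; rewrite -sqrf_eq0 sqr_enorm.
  by rewrite /dotp big1// => -[i id]; exfalso; move: id; rewrite d0.
have r0 : 0 <= r by rewrite ltW// (le_lt_trans _ (xr (Ordinal d0))).
rewrite -(@ler_pXn2r _ 2)// ?nnegrE ?enorm_ge0 ?mulr_ge0// sqr_enorm.
apply: (@le_trans _ _ (\sum_(i < d) r ^+ 2)).
  apply: ler_sum => i _; rewrite -expr2 -real_normK ?num_real//.
  by rewrite lerXn2r ?nnegrE// ltW.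
rewrite sumr_const card_ord exprMn -(mulr_natl (r ^+ 2)) ler_wpM2r ?sqr_ge0//.
by rewrite expr2 -natrM ler_nat leq_pmull.
Qed.

Lemma notin_cube_enorm r x : ~ cube r x -> r <= enorm x.
Proof.
move=> /existsNP[i] /negP; rewrite -leNgt => /le_trans; apply; exact: tnth_le_enorm.
Qed.

Lemma cube_tuple_sub r s x y : cube r x -> cube s y -> cube (s + r) (tuple_sub y x).
Proof.
move=> xr ys i; rewrite tnth_mktuple (le_lt_trans (ler_normB _ _))//.
by rewrite ltrD.
Qed.

Lemma enorm_eq0 x : enorm x = 0 -> x = origin.
Proof.
move=> x0; apply: eq_from_tnth => i; rewrite tnth_mktuple; apply/eqP.
by rewrite -normr_le0 -x0 tnth_le_enorm.
Qed.

Lemma enorm_origin : enorm (@origin R d) = 0.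
Proof.
apply/eqP; rewrite -sqrf_eq0 sqr_enorm /dotp big1// => i _.
by rewrite tnth_mktuple mul0r.
Qed.

Lemma enorm_gt0 x : x <> origin -> 0 < enorm x.
Proof.
move=> x0; rewrite lt_neqAle enorm_ge0 andbT eq_sym; apply/eqP => /enorm_eq0.
exact: x0.
Qed.

Lemma enorm_sub_gt0 x y : x <> y -> 0 < enorm (tuple_sub y x).
Proof.
move=> xy; apply: enorm_gt0 => /(congr1 (fun z => tnth z)) yx; apply: xy.
apply: eq_from_tnth => i; apply/esym/eqP; rewrite -subr_eq0.
by move: (congr1 (fun z => z i) yx); rewrite !tnth_mktuple => ->.
Qed.

Lemma measurable_dotp : measurable_fun [set: d.-tuple R * d.-tuple R]
  (fun p => dotp p.1 p.2).
Proof.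
apply: measurable_sum => i; apply: measurable_funM.
- exact: (measurableT_comp (@measurable_tnth _ R d i) measurable_fst).
- exact: (measurableT_comp (@measurable_tnth _ R d i) measurable_snd).
Qed.

Lemma measurable_sqrtr : measurable_fun [set: R] (@Num.sqrt R).
Proof. by apply: continuous_measurable_fun; exact: sqrt_continuous. Qed.

Lemma measurable_enorm : measurable_fun [set: d.-tuple R] enorm.
Proof.
apply: (measurableT_comp measurable_sqrtr).
apply: (measurableT_comp measurable_dotp (g := fun x => (x, x))).
by apply: measurable_fun_pair => //; exact: measurable_id.
Qed.

Lemma measurable_tuple_sub : measurable_fun [set: d.-tuple R * d.-tuple R]
  (fun p => tuple_sub p.2 p.1).
Proof.
apply/measurable_fun_tnthP => i.
rewrite (_ : _ \o _ = fun p => tnth p.2 i - tnth p.1 i); last first.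
  by apply/funext => p /=; rewrite tnth_mktuple.
apply: measurable_funB.
- exact: (measurableT_comp (@measurable_tnth _ R d i) measurable_snd).
- exact: (measurableT_comp (@measurable_tnth _ R d i) measurable_fst).
Qed.

End cubes.

(** * Invariance of Lebesgue measure under permutations of the coordinates *)

Section coordinate_permutations.
Context {R : realType} {d : nat}.
Implicit Types (s : {perm 'I_d}).

Definition tuple_perm s (x : d.-tuple R) : d.-tuple R :=
  [tuple tnth x (s i) | i < d].

Lemma measurable_tuple_perm s : measurable_fun setT (tuple_perm s).
Proof.
apply/measurable_fun_tnthP => i.
rewrite (_ : _ \o _ = fun x => tnth x (s i)); first exact: measurable_tnth.
by apply/funext => x /=; rewrite tnth_mktuple.
Qed.

Lemma enorm_tuple_perm s x : enorm (tuple_perm s x) = enorm x.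
Proof.
congr Num.sqrt; rewrite /dotp (reindex_inj (@perm_inj _ s^-1))/=.
by apply: eq_bigr => i _; rewrite !tnth_mktuple permKV.
Qed.

(** A pi-system generating the sigma-algebra, on which [lebesgue_box] gives the measure as a
    product, hence symmetric in the coordinates. *)
Definition boxes : set (set (d.-tuple R)) :=
  [set B | exists2 A : 'I_d -> set R, (forall i, measurable (A i)) &
    B = [set x | forall i, A i (tnth x i)]].

Lemma measurable_boxes : (measurable : set (set (d.-tuple R))) = <<s boxes >>.
Proof.
apply/seteqP; split; last first.
  apply: smallest_sub; first exact: sigma_algebra_measurable.
  by move=> _ [A mA ->]; exact: measurable_coordinates.
apply: smallest_sub; first exact: smallest_sigma_algebra.
rewrite -bigcup_seq => B [i _ [C mC <-]]; apply: sub_sigma_algebra.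
exists (fun j => if j == i then C else setT) => [j|]; first by case: ifPn.
apply/seteqP; split => x /=.
- by move=> [_ Cx] j; case: eqP => [->|].
- by move=> /(_ i); rewrite eqxx.
Qed.

Lemma setI_closed_boxes : setI_closed boxes.
Proof.
move=> _ _ [A mA ->] [B mB ->].
exists (fun i => A i `&` B i) => [i|]; first exact: measurableI.
apply/seteqP; split=> x /=; first by move=> [Ax Bx] i.
by move=> ABx; split=> i; have [] := ABx i.
Qed.

(** Two measures that agree on the boxes and are finite on the cubes [-k, k]^d coincide. On a box,
    the permutation only reindexes the product of side lengths. This carries estimates along the
    first axis over to every coordinate. *)
Lemma lebesgue_tuple_perm s (B : set (d.-tuple R)) : measurable B ->
  lebesgue R d (tuple_perm s @^-1` B) = lebesgue R d B.
Proof.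
move=> mB; pose mf := isMeasurableFun.Build _ _ _ _ _ (measurable_tuple_perm s).
pose f : {mfun _ >-> _} := HB.pack (tuple_perm s) mf.
apply: (measure_unique boxes (fun k => cube k%:R) measurable_boxes setI_closed_boxes
  _ _ (pushforward (lebesgue R d) f) (lebesgue R d)) => //.
- by move=> k; rewrite cubeE; exists (fun=> `]-k%:R, k%:R[%classic).
- apply/seteqP; split=> // x _.
  exists (Num.truncn (enorm x)).+1 => // i.
  exact: le_lt_trans (tnth_le_enorm _ _) (truncnS_gt _).
- move=> _ [A mA ->]; rewrite /pushforward/=.
  rewrite [X in lebesgue R d X = _](_ : _ = [set x | forall i, A (s^-1%g i) (tnth x i)]).
    rewrite (lebesgue_box mA) (@lebesgue_box _ _ (A \o s^-1%g))//=.
    by rewrite [RHS](reindex_inj (@perm_inj _ s^-1)).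
  apply/seteqP; split=> x /= Ax i.
    by have := Ax (s^-1%g i); rewrite tnth_mktuple permKV.
  by rewrite tnth_mktuple; have := Ax (s i); rewrite permK.
- move=> k; change (lebesgue R d (tuple_perm s @^-1` cube k%:R) < +oo)%E.
  rewrite (_ : _ @^-1` _ = cube k%:R); first by rewrite lebesgue_cube// ltry.
  apply/seteqP; split=> x /= xk i; last by rewrite tnth_mktuple.
  by have := xk (s^-1%g i); rewrite tnth_mktuple permKV.
Qed.

Lemma ge0_integral_tuple_perm s (f : d.-tuple R -> \bar R) :
  measurable_fun setT f -> (forall x, 0 <= f x)%E ->
  (\int[lebesgue R d]_x f (tuple_perm s x) = \int[lebesgue R d]_x f x)%E.
Proof.
move=> mf f0.
rewrite -[LHS](ge0_integral_pushforward (measurable_tuple_perm s) _ measurableT)//.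
apply: eq_measure_integral => [|mf' A mA _]; first exact: measurable_tuple_perm.
exact: lebesgue_tuple_perm.
Qed.

End coordinate_permutations.

(** * The Levy density and its symbol *)

Lemma measurable_cos {R : realType} : measurable_fun setT (@cos R).
Proof. by apply: continuous_measurable_fun; exact: continuous_cos. Qed.

Lemma measurable_bool_natr dsp (T : measurableType dsp) (R : realType) (b : T -> bool) :
  measurable_fun setT b -> measurable_fun setT (fun x => (b x)%:R : R).
Proof.
move=> mb; rewrite (_ : (fun x => _) = (fun x => if b x then 1 else 0)).
  by apply: measurable_fun_ifT => //; exact: measurable_cst.
by apply/funext => x; case: (b x).
Qed.

Section levy_density.
Context {R : realType} {d : nat} (nu : R -> R).
Hypothesis nu_levy : isotropic_unimodal_levy d nu.
Implicit Types (x : d.-tuple R) (r : R).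

(* The value at the origin, which no hypothesis controls, is normalized to 0. *)
Definition levy_density x : R := if 0 < enorm x then nu (enorm x) else 0.

Lemma levy_density_ge0 x : 0 <= levy_density x.
Proof.
rewrite /levy_density; case: ifP => // x0.
by have [nu0 _ _] := nu_levy; exact: nu0.
Qed.

Lemma levy_density_le r x : 0 < r -> r <= enorm x -> levy_density x <= nu r.
Proof.
move=> r0 rx; rewrite /levy_density (lt_le_trans r0 rx).
by have [_ nu1 _] := nu_levy; exact: nu1.
Qed.

Lemma levy_density_ge r x : 0 < enorm x -> enorm x <= r -> nu r <= levy_density x.
Proof.
by move=> x0 xr; rewrite /levy_density x0; have [_ nu1 _] := nu_levy; exact: nu1.
Qed.

Lemma measurable_levy_density : measurable_fun setT levy_density.
Proof.
have [_ nu1 _] := nu_levy.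
pose f r := if 0 < r then nu r else 0.
rewrite (_ : levy_density = f \o enorm)//.
apply: measurableT_comp; last exact: measurable_enorm.
apply: measurable_fun_if => //.
- by apply: measurable_fun_ltr => //; exact: measurable_cst.
- rewrite setTI (_ : _ @^-1` _ = `]0, +oo[%classic); last first.
    by apply/seteqP; split=> r /=; rewrite in_itv/= andbT.
  apply: (measurability (@RGenCInfty.G R)) => [|/= _ [_] [r] -> <-].
    exact: RGenCInfty.measurableE.
  (* As [nu] is nonincreasing, its superlevel sets inside ]0, +oo[ are intervals. *)
  apply: is_interval_measurable => s t/=; rewrite !in_itv/= !andbT.
  move=> [s0 rs] [t0 rt] u /andP[su ut]; rewrite !in_itv/= !andbT.
  split; first exact: lt_le_trans su.
  by apply: (le_trans rt); apply: nu1 => //; exact: lt_le_trans su.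
Qed.

Lemma integral_levy_density_lty :
  (\int[lebesgue R d]_x (Num.min (enorm x ^+ 2) 1 * levy_density x)%:E < +oo)%E.
Proof.
have [_ _] := nu_levy; apply: le_lt_trans; rewrite [leRHS]integral_mkcond.
rewrite le_eqVlt; apply/orP; left; apply/eqP; apply: eq_integral => x _.
rewrite patchE; case: ifPn => [|].
  by rewrite inE/= /levy_density => /enorm_gt0 ->.
rewrite notin_setE/= => /contrapT ->; rewrite enorm_origin expr0n/=.
by rewrite min_l// mul0r.
Qed.

(* The symbol as a finite integral along the first axis *)
End levy_density.

Section symbol.
Context {R : realType} {d : nat} (nu : R -> R).
Hypothesis nu_levy : isotropic_unimodal_levy d.+1 nu.
Local Notation psi := (radial_profile (@levy_symbol R d.+1 nu)).
Implicit Types (x : d.+1.-tuple R) (r rho : R).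

Lemma dotp_axis_point rho x : dotp (axis_point rho) x = rho * tnth x ord0.
Proof.
rewrite /dotp big_ord_recl big1 ?addr0 => [|i _]; first by rewrite tnth_mktuple.
by rewrite tnth_mktuple/= mul0r.
Qed.

Lemma measurable_symbol_integrand :
  measurable_fun [set: measurableTypeR R * d.+1.-tuple R]
    (fun p => (1 - cos (p.1 * tnth p.2 ord0)) * levy_density nu p.2).
Proof.
apply: measurable_funM; last first.
  exact: (measurableT_comp (measurable_levy_density nu nu_levy)).
apply: measurable_funB; first exact: measurable_cst.
apply: (measurableT_comp measurable_cos); apply: measurable_funM => //.
exact: (measurableT_comp (@measurable_tnth _ R d.+1 ord0) measurable_snd).
Qed.

Lemma measurable_symbol_integrandr rho :
  measurable_fun setT
    (fun x => ((1 - cos (rho * tnth x ord0)) * levy_density nu x)%:E).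
Proof.
apply/measurable_EFinP; apply: (measurableT_comp measurable_symbol_integrand
  (g := fun x => (rho, x))).
exact: pair1_measurable.
Qed.

Lemma symbol_integrand_ge0 rho x :
  0 <= (1 - cos (rho * tnth x ord0)) * levy_density nu x.
Proof. by rewrite mulr_ge0 ?one_sub_cos_ge0// levy_density_ge0. Qed.

(** Since 1 - cos is at most 2 and at most rho^2 |x|^2 / 2, the integrand is dominated by (2 +
    rho^2) min(|x|^2, 1) times the density. Finiteness is what allows [fine] to be removed from
    [levy_symbol]. *)
Lemma symbol_integral_lty rho :
  (\int[lebesgue R d.+1]_x
    ((1 - cos (rho * tnth x ord0)) * levy_density nu x)%:E < +oo)%E.
Proof.
have K0 : 0 <= 2 + rho ^+ 2 by rewrite addr_ge0 ?sqr_ge0.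
have mmin : measurable_fun setT
   (fun x => (Num.min (enorm x ^+ 2) 1 * levy_density nu x)%:E).
  apply/measurable_EFinP/measurable_funM; last exact: measurable_levy_density.
  apply: measurable_minr; last exact: measurable_cst.
  by apply: measurable_funX; exact: measurable_enorm.
have min0 x : (0 <= (Num.min (enorm x ^+ 2) 1 * levy_density nu x)%:E)%E.
  by rewrite lee_fin mulr_ge0 ?levy_density_ge0// le_min sqr_ge0/=.
apply: (@le_lt_trans _ _ (\int[lebesgue R d.+1]_x ((2 + rho ^+ 2)%:E *
   (Num.min (enorm x ^+ 2) 1 * levy_density nu x)%:E)))%E; last first.
  rewrite ge0_integralZl_EFin// lte_mul_pinfty ?lee_fin//.
  exact: integral_levy_density_lty.
apply: ge0_le_integral => //.
- by move=> x _; rewrite lee_fin symbol_integrand_ge0.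
- exact: measurable_symbol_integrandr.
- exact: measurable_funeM.
move=> x _; rewrite -EFinM lee_fin mulrA ler_wpM2r ?levy_density_ge0//.
have rho0 := sqr_ge0 rho.
have x0 : tnth x ord0 ^+ 2 <= enorm x ^+ 2.
  rewrite -real_normK ?num_real// lerXn2r ?nnegrE ?enorm_ge0//.
  exact: tnth_le_enorm.
have := one_sub_cos_le (rho * tnth x ord0); have := one_sub_cos_le2 (rho * tnth x ord0).
rewrite exprMn; have := sqr_ge0 (tnth x ord0).
by case: (leP (enorm x ^+ 2) 1) => _; nra.
Qed.

Lemma symbol_integralE rho : ((psi rho)%:E =
  \int[lebesgue R d.+1]_x
    ((1 - cos (rho * tnth x ord0)) * levy_density nu x)%:E)%E.
Proof.
rewrite /radial_profile /levy_symbol /Rintegral.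
rewrite [X in fine X](_ : _ = \int[lebesgue R d.+1]_x
    ((1 - cos (rho * tnth x ord0)) * levy_density nu x)%:E)%E.
  rewrite fineK// ge0_fin_numE ?symbol_integral_lty// integral_ge0// => x _.
  by rewrite lee_fin symbol_integrand_ge0.
apply: eq_integral => x _; rewrite dotp_axis_point /levy_density.
(* The two integrands can differ only at the origin, and there 1 - cos vanishes. *)
case: ifPn => //; rewrite -leNgt => x0.
rewrite (_ : tnth x ord0 = 0) ?mulr0 ?cos0 ?subrr ?mul0r//.
by apply/eqP; rewrite -normr_le0 (le_trans (tnth_le_enorm _ _)).
Qed.

Lemma symbol_ge0 rho : 0 <= psi rho.
Proof.
rewrite -lee_fin symbol_integralE integral_ge0// => x _.
by rewrite lee_fin symbol_integrand_ge0.
Qed.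

(** As 0^-1 is 0 by convention, this makes the Hardy weight vanish at the origin. *)
Lemma symbol0 : psi 0 = 0.
Proof.
apply: EFin_inj; rewrite symbol_integralE integral0_eq// => x _.
by rewrite mul0r cos0 subrr mul0r.
Qed.

Lemma measurable_symbol : measurable_fun setT psi.
Proof.
apply/measurable_EFinP; rewrite (_ : _ \o _ = fubini_F (lebesgue R d.+1)
    (fun p : measurableTypeR R * d.+1.-tuple R =>
      ((1 - cos (p.1 * tnth p.2 ord0)) * levy_density nu p.2)%:E)).
  apply: measurable_fun_fubini_tonelli_F.
    by apply/measurable_EFinP; exact: measurable_symbol_integrand.
  by move=> p; rewrite lee_fin symbol_integrand_ge0.
by apply/funext => rho; rewrite /= symbol_integralE.
Qed.

End symbol.

(** * Lower bound of the Levy density *)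

Section real_lemmas.
Context {R : realType}.

Lemma powR_unbounded (a K : R) : 0 < a ->
  (* The witness is the a-th root of max(K, 2^a): the entry 2^a gives M >= 2, so that powers of M
     grow with the exponent and one M serves all b >= a. *)
  exists M : R, 2 <= M /\ forall b, a <= b -> K <= M `^ b.
Proof.
move=> a0; pose L := Num.max K (2 `^ a); exists (L `^ a^-1).
have L2 : 2 `^ a <= L by rewrite le_max lexx orbT.
have L0 : 0 <= L by rewrite (le_trans _ L2)// powR_ge0.
have M2 : 2 <= L `^ a^-1.
  have -> : 2 = (2 `^ a) `^ a^-1 by rewrite -powRrM mulfV ?gt_eqF// powRr1.
  by apply: ge0_ler_powR; rewrite ?nnegrE ?powR_ge0 ?invr_ge0 ?(ltW a0).
split=> // b ab; apply: (@le_trans _ _ ((L `^ a^-1) `^ a)).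
  by rewrite -powRrM mulVf ?gt_eqF// powRr1// le_max lexx.
by rewrite ler_powR// (le_trans _ M2)// ler1n.
Qed.

Lemma nneseries_le (f : nat -> \bar R) (B : \bar R) :
  (forall n, 0 <= f n)%E -> (forall N, \sum_(0 <= i < N) f i <= B)%E ->
  (\sum_(0 <= i <oo) f i <= B)%E.
Proof.
move=> f0 fB; apply: lime_le; first by apply: is_cvg_nneseries => n _ _; exact: f0.
exact: nearW.
Qed.

Lemma le_nneseries (f : nat -> \bar R) n :
  (forall n, 0 <= f n)%E -> (f n <= \sum_(0 <= i <oo) f i)%E.
Proof.
move=> f0; apply: le_trans (nneseries_lim_ge n.+1 _); last by move=> i _ _; exact: f0.
by rewrite big_nat_recr//= leeDr// sume_ge0.
Qed.

Lemma dyadic_scale (r a : R) : 0 < r -> r <= a ->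
  exists j : nat, 2 ^+ j * r <= a < 2 ^+ j.+1 * r.
Proof.
move=> r0 ra.
have ex : exists k : nat, a < 2 ^+ k * r.
  exists (Num.truncn (a / r)).+1; rewrite -ltr_pdivrMr//.
  apply: (lt_le_trans (truncnS_gt _)).
  by rewrite -natrX ler_nat ltnW// ltn_expl.
case: (ex_minnP ex) => -[|k]; first by rewrite expr0 mul1r ltNge ra.
move=> ak kmin; exists k; rewrite ak andbT leNgt; apply/negP => /kmin.
by rewrite ltnn.
Qed.

End real_lemmas.

Lemma WLSC_le {R : realType} (phi : R -> R) (alow clow l t : R) :
  0 < clow -> WLSC alow clow phi -> 1 <= l -> 0 < t ->
  phi t <= clow^-1 * (l `^ alow)^-1 * phi (l * t).
Proof.
move=> clow0 phiL l1 t0.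
have l0 : 0 < l `^ alow by rewrite powR_gt0// (lt_le_trans ltr01).
by rewrite -invfM mulrC ler_pdivlMr ?mulr_gt0// mulrC phiL.
Qed.

Section density_lower_bound.
Context {R : realType} {d : nat} (nu : R -> R) (alow clow aup cup : R).
Hypothesis nu_levy : isotropic_unimodal_levy d.+1 nu.
Local Notation psi := (radial_profile (@levy_symbol R d.+1 nu)).
Hypotheses (alow0 : 0 < alow) (clow0 : 0 < clow) (cup1 : 1 <= cup) (aup2 : aup < 2).
Hypotheses (psiL : WLSC alow clow psi) (psiU : WUSC aup cup psi).
Implicit Types (x : d.+1.-tuple R) (r : R) (i : 'I_d.+1).

Lemma measurable_tail_integrand r i : measurable_fun setT
  (fun x => ((r <= `|tnth x i|)%R%:R * levy_density nu x)%:E).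
Proof.
apply/measurable_EFinP/measurable_funM; last exact: measurable_levy_density.
apply: measurable_bool_natr; apply: measurable_fun_ler; first exact: measurable_cst.
exact: (measurableT_comp (@normr_measurable _ _) (@measurable_tnth _ R d.+1 i)).
Qed.

Lemma tail_integrand_ge0 r i x : 0 <= (r <= `|tnth x i|)%R%:R * levy_density nu x.
Proof. by rewrite mulr_ge0// levy_density_ge0. Qed.

(** If |x_i| >= r, some frequency 2^-j / r brings the phase into 1 <= |t| < 2, where 1 - cos t >=
    1/3. The indicator is thus at most the sum over j of 3 (1 - cos(2^-j x_i / r)). By lower scaling
    psi(2^-j / r) <= clow^-1 q^j psi(1/r) with q = 2^-alow < 1, and the series is geometric. *)
Lemma tail_integral_le : exists2 C : R, 0 <= C & forall r i, 0 < r ->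
  (\int[lebesgue R d.+1]_x ((r <= `|tnth x i|)%R%:R * levy_density nu x)%:E <=
   (C * psi r^-1)%:E)%E.
Proof.
pose q : R := (2 `^ alow)^-1.
have q0 : 0 < q by rewrite invr_gt0 powR_gt0.
have q1 : q < 1.
  rewrite invf_lt1 ?powR_gt0// -[ltLHS]/((fun=> 1) alow) -powR1.
  by apply: gt0_ltr_powR; rewrite ?nnegrE// ltr1n.
exists (3 * clow^-1 * (1 - q)^-1).
  by rewrite !mulr_ge0// invr_ge0 ?ltW// subr_gt0.
move=> r i r0; pose f (j : nat) x : \bar R :=
  (3%:E * ((1 - cos (((2 ^+ j)^-1 * r^-1) * tnth x ord0)) * levy_density nu x)%:E)%E.
have f0 j x : (0 <= f j x)%E.
  by rewrite mule_ge0 ?lee_fin// symbol_integrand_ge0.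
have mf j : measurable_fun setT (f j).
  by apply: measurable_funeM; exact: measurable_symbol_integrandr.
(* Exchanging the coordinates i and 0 preserves the measure and |x|, so the frequencies may be taken
   along the first axis, where [psi] is computed. *)
rewrite -(ge0_integral_tuple_perm (tperm i ord0)) => [||x]; last 2 first.
- exact: measurable_tail_integrand.
- by rewrite lee_fin tail_integrand_ge0.
apply: (@le_trans _ _ (\int[lebesgue R d.+1]_x \sum_(0 <= j <oo) f j x))%E.
  apply: ge0_le_integral => //.
  - by move=> x _; rewrite lee_fin tail_integrand_ge0.
  - exact: (measurableT_comp (measurable_tail_integrand r i) (measurable_tuple_perm _)).
  - by apply: ge0_emeasurable_sum => // j x _ _; exact: f0.
  move=> x _; rewrite /levy_density enorm_tuple_perm -/(levy_density nu x).
  rewrite tnth_mktuple tpermL.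
  have [rx|_] := leP r; last by rewrite mul0r nneseries_ge0.
  have [j /andP[jx xj]] := dyadic_scale r _ r0 rx.
  apply: le_trans (le_nneseries (f ^~ x) j _) => //.
  rewrite /f -EFinM lee_fin mulrA ler_wpM2r ?levy_density_ge0//.
  set t := _ * tnth x ord0.
  have tE : `|t| = `|tnth x ord0| / (2 ^+ j * r).
    rewrite /t normrM ger0_norm ?mulr_ge0 ?invr_ge0 ?exprn_ge0 ?(ltW r0)//.
    by rewrite -invfM mulrC.
  have jr0 : 0 < 2 ^+ j * r by rewrite mulr_gt0// exprn_gt0.
  have t1 : 1 <= `|t| by rewrite tE ler_pdivlMr// mul1r.
  have t2 : `|t| <= 2 by rewrite tE ler_pdivrMr// mulrA -exprS ltW.
  have := one_sub_cos_ge t t2; rewrite -real_normK ?num_real//.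
  by have := exprn_ege1 2 t1; rewrite /=; lra.
rewrite integral_nneseries//.
apply: nneseries_le => [n|N]; first by apply: integral_ge0 => x _; exact: f0.
apply: (@le_trans _ _ (\sum_(0 <= j < N) (geometric (3 * clow^-1 * psi r^-1) q j)%:E)%E).
  apply: lee_sum => j _; rewrite /f ge0_integralZl_EFin//; last 2 first.
  - by move=> x _; rewrite lee_fin symbol_integrand_ge0.
  - exact: measurable_symbol_integrandr.
  rewrite -symbol_integralE// -EFinM lee_fin /geometric/= -!mulrA ler_pM2l//.
  have j1 : 1 <= 2 ^+ j :> R by rewrite exprn_ege1// ler1n.
  have j0 : 0 < 2 ^+ j :> R by rewrite exprn_gt0.
  have := WLSC_le psi alow clow (2 ^+ j) ((2 ^+ j)^-1 * r^-1) clow0 psiL j1.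
  rewrite mulVKf ?gt_eqF// => /(_ _)/le_trans; apply.
    by rewrite mulr_gt0 ?invr_gt0.
  rewrite -!mulrA ler_pM2l ?invr_gt0// mulrC.
  rewrite (_ : ((2 ^+ j) `^ alow)^-1 = q ^+ j)//.
  by rewrite /q exprVn -powR_mulrn// -powRrM mulrC powRrM powR_mulrn// powR_ge0.
rewrite sumEFin lee_fin.
have := @geometric_le_lim R N (3 * clow^-1 * psi r^-1) q.
rewrite ger0_norm ?(ltW q0)// => /(_ _ q0 q1)/le_trans; apply.
  by rewrite !mulr_ge0 ?invr_ge0 ?(ltW clow0)// symbol_ge0.
by rewrite mulrAC.
Qed.

(** In each of three regions one term on the right suffices. If |x_0| < r/M, put t = M x_0 / r; then
    1 - cos(t/M) <= t^2 / (2 M^2), and t^2 <= 3 (1 - cos t) because |t| <= 2. If |x_0| >= r/M and x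
    lies in the cube of radius M r, then |x| >= r/M and the density is at most nu(r/M). Otherwise
    some |x_j| >= M r. *)
Lemma symbol_integrand_le M r x : 1 <= M -> 0 < r ->
  (1 - cos (r^-1 * tnth x ord0)) * levy_density nu x <=
  3 / 2 / M ^+ 2 * ((1 - cos (M / r * tnth x ord0)) * levy_density nu x) +
  2 * nu (r / M) * \1_(cube (M * r)) x +
  \sum_(i < d.+1) 2 * ((M * r <= `|tnth x i|)%R%:R * levy_density nu x).
Proof.
move=> M1 r0; have M0 : 0 < M by rewrite (lt_le_trans ltr01).
have n0 := levy_density_ge0 nu nu_levy x.
have rM : 0 < r / M by rewrite divr_gt0.
have nuM : 0 <= nu (r / M) by have [nu0 _ _] := nu_levy; exact: nu0.
have S1 : 0 <= 3 / 2 / M ^+ 2 * ((1 - cos (M / r * tnth x ord0)) * levy_density nu x).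
  by rewrite mulr_ge0 ?symbol_integrand_ge0// !mulr_ge0 ?invr_ge0 ?exprn_ge0// ltW.
have S2 : 0 <= 2 * nu (r / M) * \1_(cube (M * r)) x.
  by rewrite !mulr_ge0// indicE ler0n.
have S3 j : 0 <= 2 * ((M * r <= `|tnth x j|)%R%:R * levy_density nu x).
  by rewrite mulr_ge0// tail_integrand_ge0.
have S3' : 0 <= \sum_(i < d.+1) 2 * ((M * r <= `|tnth x i|)%R%:R * levy_density nu x).
  by apply: sumr_ge0 => j _; exact: S3.
have [x0|x0] := ltP `|tnth x ord0| (r / M).
  rewrite -addrA; apply: ler_wpDr; first by rewrite addr_ge0// S3'.
  rewrite mulrA ler_wpM2r//.
  set t := M / r * tnth x ord0.
  have tE : r^-1 * tnth x ord0 = t / M.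
    by rewrite /t; field; rewrite !gt_eqF.
  have t1 : `|t| <= 2.
    rewrite /t normrM ger0_norm ?divr_ge0 ?(ltW M0) ?(ltW r0)//.
    rewrite mulrAC ler_pdivrMr// mulrC -ler_pdivlMr// (le_trans (ltW x0))//.
    by rewrite -mulrA ler_peMl// ?ler1n// ltW.
  rewrite tE; apply: (le_trans (one_sub_cos_le _)).
  have := one_sub_cos_ge t t1.
  rewrite expr_div_n => H; rewrite [leRHS]mulrAC [leLHS]mulrAC.
  rewrite ler_wpM2r ?invr_ge0 ?exprn_ge0 ?(ltW M0)//.
  by lra.
have [xM|xM] := pselect (cube (M * r) x).
  rewrite -addrA addrCA; apply: ler_wpDr; first by rewrite addr_ge0// S3'.
  rewrite indicE mem_set// mulr1 ler_pM ?one_sub_cos_ge0 ?one_sub_cos_le2//.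
  apply: levy_density_le => //; exact: le_trans x0 (tnth_le_enorm _ _).
move/existsNP : xM => [j /negP]; rewrite -leNgt => xj.
apply: ler_wpDl; first by rewrite addr_ge0.
rewrite (bigD1 j)//=; apply: ler_wpDr; first by apply: sumr_ge0 => i _; exact: S3.
by rewrite xj mul1r ler_wpM2r// one_sub_cos_le2.
Qed.

(** The pointwise splitting is integrated term by term. Here C bounds the tails at the single radius
    M r; it becomes a multiple of psi(1/(M r)) in the next lemma. *)
Lemma symbol_le_density (C M r : R) : 1 <= M -> 0 < r ->
  (forall i, (\int[lebesgue R d.+1]_x
     ((M * r <= `|tnth x i|)%R%:R * levy_density nu x)%:E <= C%:E)%E) ->
  psi r^-1 <= 3 / 2 / M ^+ 2 * psi (M / r) +
    2 * nu (r / M) * (2 * (M * r)) ^+ d.+1 + d.+1%:R * (2 * C).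
Proof.
move=> M1 r0 tailC; have M0 : 0 < M by rewrite (lt_le_trans ltr01).
have rM : 0 < r / M by rewrite divr_gt0.
have nuM : 0 <= nu (r / M) by have [nu0 _ _] := nu_levy; exact: nu0.
have K0 : 0 <= 3 / 2 / M ^+ 2 by rewrite !mulr_ge0 ?invr_ge0 ?exprn_ge0// ltW.
pose F x : \bar R := ((3 / 2 / M ^+ 2)%:E *
  ((1 - cos (M / r * tnth x ord0)) * levy_density nu x)%:E)%E.
pose G x : \bar R := ((2 * nu (r / M))%:E * (\1_(cube (M * r)) x)%:E)%E.
pose H i x : \bar R := (2%:E * ((M * r <= `|tnth x i|)%R%:R * levy_density nu x)%:E)%E.
have F0 x : (0 <= F x)%E by rewrite mule_ge0 ?lee_fin// symbol_integrand_ge0.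
have G0 x : (0 <= G x)%E by rewrite mule_ge0 ?lee_fin// ?mulr_ge0// indicE ler0n.
have H0 i x : (0 <= H i x)%E by rewrite mule_ge0 ?lee_fin// tail_integrand_ge0.
have mF : measurable_fun setT F.
  by apply: measurable_funeM; exact: measurable_symbol_integrandr.
have mI : measurable_fun setT (fun x => (\1_(cube (M * r)) x)%:E : \bar R).
  by apply/measurable_EFinP/measurable_indic; exact: measurable_cube.
have mG : measurable_fun setT G by exact: measurable_funeM.
have mH i : measurable_fun setT (H i).
  by apply: measurable_funeM; exact: measurable_tail_integrand.
rewrite -lee_fin symbol_integralE//.
apply: (@le_trans _ _ (\int[lebesgue R d.+1]_x (F x + G x + \sum_(i < d.+1) H i x)))%E.
  apply: ge0_le_integral => //.
  - by move=> x _; rewrite lee_fin symbol_integrand_ge0.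
  - exact: measurable_symbol_integrandr.
  - by apply: emeasurable_funD; [exact: emeasurable_funD|exact: emeasurable_sum].
  move=> x _; rewrite /F /G /H.
  under eq_bigr do rewrite -EFinM.
  by rewrite sumEFin -!EFinM -!EFinD lee_fin symbol_integrand_le.
rewrite ge0_integralD//; last 4 first.
- by move=> x _; rewrite adde_ge0.
- exact: emeasurable_funD.
- by move=> x _; rewrite sume_ge0.
- exact: emeasurable_sum.
rewrite ge0_integralD// ge0_integral_sum// !EFinD; apply: leeD; first apply: leeD.
- rewrite /F ge0_integralZl_EFin//; last 2 first.
  + by move=> x _; rewrite lee_fin symbol_integrand_ge0.
  + exact: measurable_symbol_integrandr.
  by rewrite -symbol_integralE// -EFinM.
- rewrite /G ge0_integralZl_EFin//; last first.
    by rewrite mulr_ge0.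
  rewrite integral_indic ?setIT; [|exact: measurableT|exact: measurable_cube].
  rewrite [X in (_ * X <= _)%E](_ : _ = ((2 * (M * r)) ^+ d.+1)%:E).
    by rewrite -EFinM.
  by apply: lebesgue_cube; rewrite mulr_ge0// ltW.
rewrite [leRHS](_ : _ = (\sum_(i < d.+1) (2 * C)%:E)%E); last first.
  by rewrite sumEFin sumr_const card_ord mulr_natl.
apply: lee_sum => i _; rewrite /H ge0_integralZl_EFin//; last 2 first.
- by move=> x _; rewrite lee_fin tail_integrand_ge0.
- exact: measurable_tail_integrand.
by rewrite EFinM lee_pmul2l.
Qed.

(** For large M the inner and the outer part are each at most psi(1/r)/4, so the middle one carries
    at least half of psi(1/r). *)
Lemma density_lower_bound : exists2 c : R, 0 < c &
  forall r, 0 < r -> c * psi r^-1 <= r ^+ d.+1 * nu r.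
Proof.
have [C C0 tailC] := tail_integral_le.
(* The first summand yields (3/2) cup M^(aup-2) <= 1/4 for the inner part, the second 2 (d+1) C
   clow^-1 M^-alow <= 1/4 for the tails. *)
pose K := 6 * cup + 8 * d.+1%:R * C * clow^-1.
have dC : 0 <= 8 * d.+1%:R * C * clow^-1 by rewrite !mulr_ge0// invr_ge0 ltW.
have K0 : 0 < K by rewrite ltr_wpDr// mulr_gt0// (lt_le_trans ltr01).
have a0 : 0 < Num.min alow (2 - aup) by rewrite lt_min alow0 subr_gt0.
have [M [M2 Mb]] := powR_unbounded _ K a0.
have M1 : 1 <= M by rewrite (le_trans _ M2)// ler1n.
have {Mb}[Ma Mb] : K <= M `^ alow /\ K <= M `^ (2 - aup).
  by split; apply: Mb; rewrite ge_min lexx ?orbT.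
have M0 : 0 < M by rewrite (lt_le_trans ltr01).
have cup0 : 0 < cup by rewrite (lt_le_trans ltr01).
have Maup0 : 0 < M `^ aup by rewrite powR_gt0.
have key r : 0 < r -> psi r^-1 <= 4 * (2 * (M * r)) ^+ d.+1 * nu (r / M).
  move=> r0; have ri : 0 < r^-1 by rewrite invr_gt0.
  have p0 : 0 <= psi r^-1 := symbol_ge0 nu nu_levy _.
  have := symbol_le_density (C * psi (M * r)^-1) M r M1 r0
    (fun i => tailC _ i (mulr_gt0 M0 r0)).
  have H1 : 3 / 2 / M ^+ 2 * psi (M / r) <= 4^-1 * psi r^-1.
    apply: (@le_trans _ _ (3 / 2 / M ^+ 2 * (cup * M `^ aup * psi r^-1))).
      by rewrite ler_wpM2l ?psiU// !mulr_ge0 ?invr_ge0 ?exprn_ge0// ltW.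
    have Q : (M ^+ 2)^-1 * M `^ aup = (M `^ (2 - aup))^-1.
      rewrite -powRN opprB powRB ?(gt_eqF M0) ?implybT// powR_mulrn ?(ltW M0)//.
      by rewrite mulrC.
    rewrite mulrA ler_wpM2r// (_ : _ * _ = 3 / 2 * cup * (M `^ (2 - aup))^-1).
      by rewrite ler_pdivrMr ?powR_gt0//; have := dC; move: Mb; rewrite /K; lra.
    by rewrite -Q; ring.
  have H2 : d.+1%:R * (2 * (C * psi (M * r)^-1)) <= 4^-1 * psi r^-1.
    have := WLSC_le psi alow clow M (M * r)^-1 clow0 psiL M1.
    have dC0 := mulr_ge0 (ler0n R d.+1) (mulr_ge0 (ler0n R 2) C0).
    rewrite invfM mulVKf ?gt_eqF// => /(_ _)/(ler_wpM2l dC0) H2.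
    have {}H2 := H2 (mulr_gt0 _ _).
    rewrite !mulrA in H2 *; apply: (le_trans (H2 _ _)) => //; first by rewrite invr_gt0.
    rewrite ler_wpM2r// ler_pdivrMr ?powR_gt0//.
    by move: Ma; rewrite /K; lra.
  set X := 2 * (M * r).
  by lra.
exists (4 * (2 * (M * M)) ^+ d.+1 * (cup * M `^ aup))^-1.
  by rewrite invr_gt0 !mulr_gt0// exprn_gt0// !mulr_gt0.
move=> r r0; rewrite ler_pdivrMl; last by rewrite !mulr_gt0// exprn_gt0// !mulr_gt0.
(* [key] at M r puts the density at r; upper scaling then turns psi(1/(M r)) back into psi(1/r). *)
have Mr0 : 0 < M * r by rewrite mulr_gt0.
have := key _ Mr0; rewrite [M * r / M]mulrAC divff ?gt_eqF// mul1r.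
have /(_ _)/le_trans H := psiU M (M * r)^-1 M1.
rewrite invfM mulVKf ?gt_eqF// in H.
move=> kr; apply: H; first by rewrite mulr_gt0// invr_gt0.
rewrite -invfM; apply: le_trans (ler_wpM2l _ kr) _; first by rewrite mulr_ge0 ?ltW.
by rewrite le_eqVlt !exprMn; apply/orP; left; apply/eqP; ring.
Qed.

End density_lower_bound.

(** * Hardy's inequality *)

Section shells.
Context {R : realType} {d : nat} (M s : R).
Hypotheses (M2 : 2 <= M) (s0 : 0 < s).
Implicit Types (x y : d.+1.-tuple R) (n : nat).

Let M0 : 0 < M. Proof. by rewrite (lt_le_trans _ M2). Qed.
Let M1 : 1 <= M. Proof. by rewrite (le_trans _ M2)// ler1n. Qed.

(** Sup-norm shells have explicit volumes; s > 0 keeps them away from the origin, where the weight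
    psi(1/|x|) may be unbounded. *)
Definition shell n : set (d.+1.-tuple R) :=
  cube (s * M ^+ n.+1) `\` cube (s * M ^+ n).

Lemma measurable_shell n : measurable (shell n).
Proof. by apply: measurableD; exact: measurable_cube. Qed.

Lemma radius_gt0 n : 0 < s * M ^+ n.
Proof. by rewrite mulr_gt0// exprn_gt0. Qed.

Lemma radius_le m n : (m <= n)%N -> s * M ^+ m <= s * M ^+ n.
Proof. by move=> mn; rewrite ler_pM2l// ler_weXn2l. Qed.

Lemma lebesgue_shell n : lebesgue R d.+1 (shell n) =
  ((2 * (s * M ^+ n)) ^+ d.+1 * (M ^+ d.+1 - 1))%:E.
Proof.
have volE k : lebesgue R d.+1 (cube (s * M ^+ k)) = ((2 * (s * M ^+ k)) ^+ d.+1)%:E.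
  by apply: lebesgue_cube; rewrite ltW// radius_gt0.
rewrite /shell measureD; last 3 first.
- exact: measurable_cube.
- exact: measurable_cube.
- rewrite [X in (X < _)%E](_ : _ = ((2 * (s * M ^+ n.+1)) ^+ d.+1)%:E) ?ltry//.
  exact: volE.
rewrite setIidr; last by apply: sub_cube; exact: radius_le.
rewrite [X in (X - _)%E](_ : _ = ((2 * (s * M ^+ n.+1)) ^+ d.+1)%:E); last exact: volE.
rewrite [X in (_ - X)%E](_ : _ = ((2 * (s * M ^+ n)) ^+ d.+1)%:E); last exact: volE.
by rewrite -EFinB mulrBr mulr1 -exprMn (exprSr M n) !mulrA.
Qed.

Lemma bigcup_shell : \bigcup_n shell n = ~` cube s.
Proof.
apply/seteqP; split=> x /=.
  move=> [n _ [_ xn] xs]; apply: xn; apply: sub_cube xs.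
  by rewrite -[leLHS]mulr1 -(expr0 M) radius_le.
move=> xs.
have ex : exists k, `[< cube (s * M ^+ k) x >].
  exists (Num.truncn (enorm x / s)).+1; apply/asboolP => i.
  apply: (le_lt_trans (tnth_le_enorm _ _)).
  rewrite mulrC -ltr_pdivrMr//; apply: (lt_le_trans (truncnS_gt _)).
  apply: (@le_trans _ _ (2 ^+ (Num.truncn (enorm x / s)).+1)).
    by rewrite -natrX ler_nat ltnW// ltn_expl.
  by rewrite lerXn2r ?nnegrE// ltW.
case: (ex_minnP ex) => -[|k] /asboolP xk kmin; first by move: xk; rewrite expr0 mulr1.
by exists k => //; split=> // /asboolP /kmin; rewrite ltnn.
Qed.

Lemma trivIset_shell : trivIset setT shell.
Proof.
suff H m n : (m < n)%N -> shell m `&` shell n = set0.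
  apply/trivIsetP => m n _ _; rewrite neq_ltn => /orP[|] mn; first exact: H.
  by rewrite setIC; exact: H.
move=> mn; rewrite -subset0 => x [[xm _] [_ xn]]; apply: xn.
exact: sub_cube (radius_le _ _ mn) _ xm.
Qed.

Lemma shell_enorm_ge n x : shell n x -> s * M ^+ n <= enorm x.
Proof. by move=> [_ /notin_cube_enorm]. Qed.

Lemma shell_sub_enorm_le n x y : shell n x -> shell n.+1 y ->
  enorm (tuple_sub y x) <= 2 * d.+1%:R * M ^+ 2 * (s * M ^+ n).
Proof.
move=> [xn _] [yn _].
apply: le_trans (enorm_le_cube _ _ (cube_tuple_sub _ _ _ _ xn yn)) _.
apply: (@le_trans _ _ (d.+1%:R * (s * M ^+ n.+2 + s * M ^+ n.+2))).
  by rewrite ler_wpM2l// lerD2l radius_le.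
by rewrite le_eqVlt !exprSr; apply/orP; left; apply/eqP; ring.
Qed.

Lemma shell_neq n x y : shell n x -> shell n.+1 y -> x <> y.
Proof. by move=> [xn _] [_ yn] xy; apply: yn; rewrite -xy. Qed.

End shells.

Lemma nneseries_shiftS {R : realType} (f : nat -> \bar R) :
  (forall n, 0 <= f n)%E -> (\sum_(0 <= n <oo) f n.+1 <= \sum_(0 <= n <oo) f n)%E.
Proof.
move=> f0; apply: nneseries_le => // N.
apply: le_trans (nneseries_lim_ge N.+1 _); last by move=> i _ _; exact: f0.
by rewrite big_nat_recl//= leeDr.
Qed.

(** * Comparison of consecutive shells, summation, and passage to the whole space *)

Section hardy.
Context {R : realType} {d : nat} (nu : R -> R) (alow clow aup cup : R).
Hypothesis nu_levy : isotropic_unimodal_levy d.+1 nu.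
Local Notation psi := (radial_profile (@levy_symbol R d.+1 nu)).
Hypotheses (alow0 : 0 < alow) (clow0 : 0 < clow) (cup1 : 1 <= cup).
Hypotheses (psiL : WLSC alow clow psi) (psiU : WUSC aup cup psi).
Variables (M c0 : R).
Hypotheses (M2 : 2 <= M) (MK : 4 * cup <= M `^ (d.+1%:R - aup)) (c0_gt0 : 0 < c0).
Hypothesis density_ge : forall r, 0 < r -> c0 * psi r^-1 <= r ^+ d.+1 * nu r.
Implicit Types (x y : d.+1.-tuple R) (r s : R).

Let M0 : 0 < M. Proof. by rewrite (lt_le_trans _ M2). Qed.
Let M1 : 1 <= M. Proof. by rewrite (le_trans _ M2)// ler1n. Qed.
Let cup0 : 0 < cup. Proof. by rewrite (lt_le_trans ltr01). Qed.
Let psi_ge0 r : 0 <= psi r := symbol_ge0 nu nu_levy r.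

(** Lower scaling with the factor (b/a)^alow >= 1 dropped; it stands in for monotonicity of
    [psi]. *)
Lemma symbol_almost_increasing (a b : R) : 0 < a -> a <= b -> psi a <= clow^-1 * psi b.
Proof.
move=> a0 ab; have ba1 : 1 <= b / a by rewrite ler_pdivlMr// mul1r.
have := WLSC_le psi alow clow (b / a) a clow0 psiL ba1 a0.
rewrite mulfVK ?gt_eqF// => /le_trans; apply.
rewrite ler_wpM2r// ler_piMr ?invr_ge0 ?(ltW clow0)//.
by rewrite invf_le1 ?powR_gt0 ?(lt_le_trans ltr01)// -(powRr0 (b / a)) ler_powR// ltW.
Qed.

(* [2 * d.+1%:R * M ^+ 2] is the ratio between the bound on the length of a jump
   from one shell to the next and the inner radius of the first one. *)
Definition hardy_constant : R :=
  2 * cup * (2 * d.+1%:R * M ^+ 2) `^ aup / c0 * (d.+1%:R * M) ^+ d.+1.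

Lemma hardy_constant_gt0 : 0 < hardy_constant.
Proof.
have D0 : 0 < d.+1%:R :> R by [].
have k0 : 0 < 2 * d.+1%:R * M ^+ 2 by rewrite !mulr_gt0// exprn_gt0.
by rewrite /hardy_constant !mulr_gt0 ?invr_gt0// ?powR_gt0 ?exprn_gt0// mulr_gt0.
Qed.

(** As M^(d+1) >= 2, a shell is at least as large as the cube it surrounds. This disposes of the
    factor M^(d+1) - 1 in lower bounds of volumes. *)
Lemma shell_volume_ge s n : 0 < s ->
  (2 * (s * M ^+ n)) ^+ d.+1 <= (2 * (s * M ^+ n)) ^+ d.+1 * (M ^+ d.+1 - 1).
Proof.
move=> s0; apply: ler_peMr.
  by rewrite exprn_ge0// mulr_ge0// ltW// (radius_gt0 M s M2 s0).
rewrite lerBrDr (_ : 1 + 1 = 2 :> R)// (le_trans M2)// exprS ler_peMr ?(ltW M0)//.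
by rewrite exprn_ege1.
Qed.

(** The left side is the weight with which [shell_pointwise_le] averages over the next shell. With r
    the inner radius, the jump is no longer than k r, so its density is at least nu(k r). The lower
    bound on [nu] brings in psi(1/(k r)), and upper scaling returns to psi(1/r). *)
Lemma jump_rate_le s n x y : 0 < s -> shell M s n x -> shell M s n.+1 y ->
  2 * psi (s * M ^+ n)^-1 / ((2 * (s * M ^+ n.+1)) ^+ d.+1 * (M ^+ d.+1 - 1)) <=
  hardy_constant * levy_density nu (tuple_sub y x).
Proof.
move=> s0 xn yn; set r := s * M ^+ n.
have D1 : 1 <= d.+1%:R :> R by rewrite ler1n.
have D0 : 0 < d.+1%:R :> R by [].
have r0 : 0 < r by exact: radius_gt0.
pose k := 2 * d.+1%:R * M ^+ 2.
have M21 : 1 <= M ^+ 2 by rewrite exprn_ege1.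
have k1 : 1 <= k by rewrite /k; nra.
have k0 : 0 < k by rewrite (lt_le_trans ltr01).
have kr0 : 0 < k * r by rewrite mulr_gt0.
have xy0 : 0 < enorm (tuple_sub y x) by apply: enorm_sub_gt0; exact: shell_neq xn yn.
have nuJ := levy_density_ge nu nu_levy (k * r) _ xy0
  (shell_sub_enorm_le M s M2 s0 n x y xn yn).
apply: le_trans (ler_wpM2l (ltW hardy_constant_gt0) nuJ).
have vol : (2 * r * M) ^+ d.+1 <= (2 * (s * M ^+ n.+1)) ^+ d.+1 * (M ^+ d.+1 - 1).
  by rewrite -!mulrA -exprSr; exact: shell_volume_ge.
have vol0 : 0 < (2 * r * M) ^+ d.+1 by rewrite exprn_gt0// mulr_gt0// mulr_gt0.
rewrite ler_pdivrMr; last exact: lt_le_trans vol0 vol.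
have nu0 : 0 <= nu (k * r) by have [h _ _] := nu_levy; exact: h.
apply: le_trans (ler_wpM2l (mulr_ge0 (ltW hardy_constant_gt0) nu0) vol).
have p1 : psi r^-1 <= cup * k `^ aup * psi (k * r)^-1.
  have := psiU k (k * r)^-1 k1; rewrite invfM mulVKf ?gt_eqF//; apply.
  by rewrite mulr_gt0// invr_gt0.
have p2 : psi (k * r)^-1 <= c0^-1 * ((k * r) ^+ d.+1 * nu (k * r)).
  by rewrite ler_pdivlMl// density_ge.
have ck0 : 0 <= cup * k `^ aup by rewrite mulr_ge0 ?powR_ge0// ltW.
apply: (le_trans (ler_wpM2l (ler0n R 2) (le_trans p1 (ler_wpM2l ck0 p2)))).
rewrite /hardy_constant -/k le_eqVlt; apply/orP; left; apply/eqP.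
(* This splits (k r)^(d+1) into the last factor of [hardy_constant] and the volume bound [vol]. *)
have -> : k * r = (d.+1%:R * M) * (2 * r * M) by rewrite /k; ring.
by rewrite [in LHS]exprMn; ring.
Qed.

(** The volumes have ratio M^-(d+1) and upper scaling costs cup M^aup, so the coefficient is 2 cup
    M^(aup-d-1), at most 1/2 by [MK]. Here the condition that aup lies below the dimension takes
    effect. *)
Lemma shell_ratio_le s n : 0 < s ->
  2 * psi (s * M ^+ n)^-1 / ((2 * (s * M ^+ n.+1)) ^+ d.+1 * (M ^+ d.+1 - 1)) *
    ((2 * (s * M ^+ n)) ^+ d.+1 * (M ^+ d.+1 - 1)) <= 2^-1 * psi (s * M ^+ n.+1)^-1.
Proof.
move=> s0; set r := s * M ^+ n.
have r0 : 0 < r by exact: radius_gt0.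
have -> : s * M ^+ n.+1 = M * r by rewrite /r exprS; ring.
have W0 : M ^+ d.+1 - 1 != 0.
  by rewrite gt_eqF// subr_gt0 exprn_egt1// (lt_le_trans _ M2)// ltr1n.
have -> : 2 * psi r^-1 / ((2 * (M * r)) ^+ d.+1 * (M ^+ d.+1 - 1)) *
    ((2 * r) ^+ d.+1 * (M ^+ d.+1 - 1)) = 2 * psi r^-1 / M ^+ d.+1.
  by rewrite !exprMn; field; rewrite W0 !expf_neq0 ?gt_eqF.
have p1 : psi r^-1 <= cup * M `^ aup * psi (M * r)^-1.
  have := psiU M (M * r)^-1 M1; rewrite invfM mulVKf ?gt_eqF//; apply.
  by rewrite mulr_gt0// invr_gt0.
rewrite ler_pdivrMr ?exprn_gt0//.
have Md : M ^+ d.+1 = M `^ (d.+1%:R - aup) * M `^ aup.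
  by rewrite -powRD ?(gt_eqF M0) ?implybT// subrK powR_mulrn// ltW.
have := ler_wpM2r (mulr_ge0 (powR_ge0 M aup) (psi_ge0 (M * r)^-1)) MK.
by rewrite Md; lra.
Qed.

Definition jump_energy (u : d.+1.-tuple R -> R) x : \bar R :=
  (\int[lebesgue R d.+1]_y
    ((u x - u y) ^+ 2 * levy_density nu (tuple_sub y x))%:E)%E.

Section energy.
Variable u : d.+1.-tuple R -> R.
Hypothesis mu : measurable_fun setT u.

Lemma jump_integrand_ge0 x y : 0 <= (u x - u y) ^+ 2 * levy_density nu (tuple_sub y x).
Proof. by rewrite mulr_ge0 ?sqr_ge0// levy_density_ge0. Qed.

Lemma measurable_jump_integrand : measurable_fun setT
  (fun p : d.+1.-tuple R * d.+1.-tuple R =>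
    ((u p.1 - u p.2) ^+ 2 * levy_density nu (tuple_sub p.2 p.1))%:E).
Proof.
apply/measurable_EFinP/measurable_funM.
  apply: measurable_funX; apply: measurable_funB.
  - exact: (measurableT_comp mu measurable_fst).
  - exact: (measurableT_comp mu measurable_snd).
exact: (measurableT_comp (measurable_levy_density nu nu_levy) measurable_tuple_sub).
Qed.

Lemma measurable_jump_energy : measurable_fun setT (jump_energy u).
Proof.
apply: (measurable_fun_fubini_tonelli_F _ measurable_jump_integrand) => p.
by rewrite lee_fin jump_integrand_ge0.
Qed.

Lemma jump_energy_ge0 x : (0 <= jump_energy u x)%E.
Proof. by apply: integral_ge0 => y _; rewrite lee_fin jump_integrand_ge0. Qed.

Lemma measurable_jump_integrandr x : measurable_fun setT
  (fun y => ((u x - u y) ^+ 2 * levy_density nu (tuple_sub y x))%:E).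
Proof.
apply: (measurableT_comp measurable_jump_integrand (g := fun y => (x, y))).
exact: pair1_measurable.
Qed.

Lemma measurable_sqr : measurable_fun setT (fun x => (u x ^+ 2)%:E).
Proof. by apply/measurable_EFinP; exact: measurable_funX. Qed.

Let sqr_ge0E x : (0 <= (u x ^+ 2)%:E)%E.
Proof. by rewrite lee_fin sqr_ge0. Qed.

Lemma shell_pointwise_le s n x : 0 < s -> shell M s n x ->
  ((psi (s * M ^+ n)^-1 * u x ^+ 2)%:E <=
   hardy_constant%:E * jump_energy u x +
   (2 * psi (s * M ^+ n)^-1 / ((2 * (s * M ^+ n.+1)) ^+ d.+1 * (M ^+ d.+1 - 1)))%:E *
     \int[lebesgue R d.+1]_(y in shell M s n.+1) (u y ^+ 2)%:E)%E.
Proof.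
move=> s0 xn; set v := _ * (M ^+ d.+1 - 1); set phi := psi _.
set k := 2 * phi / v.
have v0 : 0 < v.
  apply: lt_le_trans (shell_volume_ge s n.+1 s0).
  by rewrite exprn_gt0// mulr_gt0// (radius_gt0 M s M2 s0).
have phi0 : 0 <= phi by exact: psi_ge0.
have k0 : 0 <= k by rewrite /k !mulr_ge0// invr_ge0 ltW.
have h0 := ltW hardy_constant_gt0.
have mS := @measurable_shell R d M s n.+1.
pose f y : \bar R := ((u x - u y) ^+ 2 * levy_density nu (tuple_sub y x))%:E.
have f0 y : (0 <= f y)%E by rewrite lee_fin jump_integrand_ge0.
have mf : measurable_fun (shell M s n.+1) f.
  exact: measurable_funTS (measurable_jump_integrandr x).
have mu2 : measurable_fun (shell M s n.+1) (fun y => (u y ^+ 2)%:E).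
  exact: measurable_funTS measurable_sqr.
(* The left side becomes the integral of a constant over the next shell, of volume v, so that it can
   be compared with the right side pointwise in y. *)
rewrite (_ : (phi * u x ^+ 2)%:E =
    \int[lebesgue R d.+1]_(y in shell M s n.+1)
      (cst (phi / v * u x ^+ 2)%:E y))%E; last first.
  rewrite integral_cst//.
  rewrite [X in _ = (_ * X)%E](_ : _ = v%:E); last exact: (lebesgue_shell M s M2 s0).
  by rewrite -EFinM; congr EFin; field; rewrite gt_eqF.
pose g y : \bar R := (hardy_constant%:E * f y + k%:E * (u y ^+ 2)%:E)%E.
apply: (@le_trans _ _ (\int[lebesgue R d.+1]_(y in shell M s n.+1) g y))%E.
  apply: ge0_le_integral => //.
  - by move=> y _; rewrite /cst lee_fin mulr_ge0 ?sqr_ge0// divr_ge0// ltW.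
  - by apply: emeasurable_funD; exact: measurable_funeM.
  move=> y yn; rewrite /g /f -!EFinM -EFinD lee_fin.
  have kJ : k <= hardy_constant * levy_density nu (tuple_sub y x).
    exact: jump_rate_le.
  (* The difference of the two sides is (u x - 2 u y)^2 / 2. *)
  have sq : 2^-1 * u x ^+ 2 <= (u x - u y) ^+ 2 + u y ^+ 2.
    by have := sqr_ge0 (u x - 2 * u y); lra.
  apply: (@le_trans _ _ (k * ((u x - u y) ^+ 2 + u y ^+ 2))).
    rewrite (_ : phi / v * u x ^+ 2 = k * (2^-1 * u x ^+ 2)); last first.
      by rewrite /k; field; rewrite gt_eqF.
    exact: ler_wpM2l.
  by have := ler_wpM2r (sqr_ge0 (u x - u y)) kJ; rewrite mulrDr lerD2r; lra.
rewrite ge0_integralD//; last 4 first.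
- by move=> y _; rewrite mule_ge0.
- exact: measurable_funeM.
- by move=> y _; rewrite mule_ge0.
- exact: measurable_funeM.
rewrite !ge0_integralZl_EFin//; apply: leeD2r; apply: lee_wpmul2l => //.
apply: ge0_subset_integral => //; exact: measurable_jump_integrandr.
Qed.

(** Integration of [shell_pointwise_le] over the shell: its last term is constant in x and picks up
    the volume of the shell, which [shell_ratio_le] converts into the factor 1/2. *)
Lemma shell_step s n : 0 < s ->
  ((psi (s * M ^+ n)^-1)%:E * \int[lebesgue R d.+1]_(x in shell M s n) (u x ^+ 2)%:E <=
   hardy_constant%:E * \int[lebesgue R d.+1]_(x in shell M s n) jump_energy u x +
   (2^-1)%:E * ((psi (s * M ^+ n.+1)^-1)%:E *
     \int[lebesgue R d.+1]_(x in shell M s n.+1) (u x ^+ 2)%:E))%E.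
Proof.
move=> s0; have mS := @measurable_shell R d M s n.
have h0 := ltW hardy_constant_gt0.
have mu2 : measurable_fun (shell M s n) (fun y => (u y ^+ 2)%:E).
  exact: measurable_funTS measurable_sqr.
have me : measurable_fun (shell M s n) (jump_energy u).
  exact: measurable_funTS measurable_jump_energy.
rewrite -ge0_integralZl_EFin//.
set W := (\int[_]_(x in shell M s n.+1) _)%E.
have W0 : (0 <= W)%E by exact: integral_ge0.
pose k := 2 * psi (s * M ^+ n)^-1 / ((2 * (s * M ^+ n.+1)) ^+ d.+1 * (M ^+ d.+1 - 1)).
have v0 m : 0 < (2 * (s * M ^+ m)) ^+ d.+1 * (M ^+ d.+1 - 1).
  apply: lt_le_trans (shell_volume_ge s m s0).
  by rewrite exprn_gt0// mulr_gt0// (radius_gt0 M s M2 s0).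
have k0 : 0 <= k by rewrite /k mulr_ge0 ?invr_ge0 ?(ltW (v0 _))// mulr_ge0// psi_ge0.
pose g x : \bar R := (hardy_constant%:E * jump_energy u x + cst (k%:E * W) x)%E.
apply: (@le_trans _ _ (\int[lebesgue R d.+1]_(x in shell M s n) g x))%E.
  apply: ge0_le_integral => //.
  - by move=> x _; rewrite mule_ge0// lee_fin psi_ge0.
  - exact: measurable_funeM.
  - by apply: emeasurable_funD; [exact: measurable_funeM|exact: measurable_cst].
  by move=> x xn; rewrite -EFinM shell_pointwise_le.
rewrite ge0_integralD//; last 3 first.
- by move=> x _; rewrite mule_ge0// jump_energy_ge0.
- exact: measurable_funeM.
- by move=> x _; rewrite mule_ge0.
rewrite ge0_integralZl_EFin//; last by move=> x _; exact: jump_energy_ge0.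
apply: leeD2l; rewrite integral_cst//.
rewrite [X in (_ * X <= _)%E](_ : _ =
    ((2 * (s * M ^+ n)) ^+ d.+1 * (M ^+ d.+1 - 1))%:E); last first.
  exact: (lebesgue_shell M s M2 s0).
rewrite muleAC -EFinM muleA -EFinM lee_wpmul2r// lee_fin.
exact: shell_ratio_le.
Qed.

(** The a_n of the opening sketch: the weight is frozen at the inner radius of the shell. *)
Definition sq_shell s n : \bar R :=
  ((psi (s * M ^+ n)^-1)%:E * \int[lebesgue R d.+1]_(x in shell M s n) (u x ^+ 2)%:E)%E.

Local Notation energy := (\int[lebesgue R d.+1]_x jump_energy u x)%E.

Let sq_shell_ge0 s n : (0 <= sq_shell s n)%E.
Proof. by rewrite mule_ge0 ?lee_fin ?psi_ge0//; exact: integral_ge0. Qed.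

Let energy_ge0 : (0 <= energy)%E.
Proof. by apply: integral_ge0 => x _; exact: jump_energy_ge0. Qed.

Lemma shell_sum_integral s (f : d.+1.-tuple R -> \bar R) : 0 < s ->
  measurable_fun setT f -> (forall x, 0 <= f x)%E ->
  (\sum_(0 <= n <oo) \int[lebesgue R d.+1]_(x in shell M s n) f x =
   \int[lebesgue R d.+1]_(x in ~` cube s) f x)%E.
Proof.
move=> s0 mf f0; rewrite -(bigcup_shell M s M2 s0) ge0_integral_bigcup//.
- by move=> k; exact: measurable_shell.
- exact: measurable_funTS.
- exact: trivIset_shell.
Qed.

Lemma sq_shell_sum_lty s : 0 < s ->
  (\int[lebesgue R d.+1]_x (u x ^+ 2)%:E < +oo)%E ->
  (\sum_(0 <= n <oo) sq_shell s n < +oo)%E.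
Proof.
move=> s0 uoo; pose K := clow^-1 * psi s^-1.
have K0 : 0 <= K by rewrite mulr_ge0 ?psi_ge0// invr_ge0 ltW.
apply: (@le_lt_trans _ _ (\sum_(0 <= n <oo)
    (K%:E * \int[lebesgue R d.+1]_(x in shell M s n) (u x ^+ 2)%:E)))%E.
  apply: lee_nneseries => [n _ _|n _]; first exact: sq_shell_ge0.
  apply: lee_wpmul2r; first exact: integral_ge0.
  rewrite lee_fin symbol_almost_increasing// ?invr_gt0 ?(radius_gt0 M s M2 s0)//.
  rewrite lef_pV2 ?posrE ?(radius_gt0 M s M2 s0)//.
  by rewrite ler_peMr ?(ltW s0)// exprn_ege1.
rewrite nneseriesZl; last by move=> n _; exact: integral_ge0.
rewrite shell_sum_integral//; last exact: measurable_sqr.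
rewrite lte_mul_pinfty ?lee_fin//; apply: le_lt_trans uoo.
apply: ge0_subset_integral => //; last exact: measurable_sqr.
by apply: measurableC; exact: measurable_cube.
Qed.

(** Summing [shell_step] over n gives T <= H E + T/2, where H is [hardy_constant] and E the energy,
    because dropping the first term of the series does not increase it. As T is finite, T/2 can be
    subtracted. *)
Lemma sq_shell_sum_le s : 0 < s ->
  (\int[lebesgue R d.+1]_x (u x ^+ 2)%:E < +oo)%E ->
  (\sum_(0 <= n <oo) sq_shell s n <= (2 * hardy_constant)%:E * energy)%E.
Proof.
move=> s0 uoo; set T := (X in (X <= _)%E).
have h0 := ltW hardy_constant_gt0.
have T0 : (0 <= T)%E by apply: nneseries_ge0 => n _ _; exact: sq_shell_ge0.
have Tfin : T \is a fin_num by rewrite ge0_fin_numE// sq_shell_sum_lty.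
have TE : (T <= hardy_constant%:E * energy + (2^-1)%:E * T)%E.
  apply: (@le_trans _ _ (\sum_(0 <= n <oo)
    (hardy_constant%:E * \int[lebesgue R d.+1]_(x in shell M s n) jump_energy u x +
     (2^-1)%:E * sq_shell s n.+1)))%E.
    by apply: lee_nneseries => [n _ _|n _]; [exact: sq_shell_ge0|exact: shell_step].
  have e0 n : (0 <= \int[lebesgue R d.+1]_(x in shell M s n) jump_energy u x)%E.
    by apply: integral_ge0 => x _; exact: jump_energy_ge0.
  rewrite nneseriesD; last 2 first.
  - by move=> n _ _; rewrite mule_ge0.
  - by move=> n _ _; rewrite mule_ge0 ?sq_shell_ge0// lee_fin.
  rewrite nneseriesZl; last by move=> n _; exact: e0.
  rewrite nneseriesZl; last by move=> n _; exact: sq_shell_ge0.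
  apply: leeD.
    apply: lee_wpmul2l; first by rewrite lee_fin.
    rewrite shell_sum_integral//; last 2 first.
    - exact: measurable_jump_energy.
    - by move=> x; exact: jump_energy_ge0.
    apply: ge0_subset_integral => //.
    - by apply: measurableC; exact: measurable_cube.
    - exact: measurable_jump_energy.
    - by move=> x _; exact: jump_energy_ge0.
  apply: lee_wpmul2l; first by rewrite lee_fin.
  by apply: nneseries_shiftS => n; exact: sq_shell_ge0.
(* For finite energy this is real arithmetic; for infinite energy the bound is +oo. *)
move: TE energy_ge0; rewrite -(fineK Tfin); case: energy => [e| |]//.
  by rewrite -!EFinM -EFinD !lee_fin => TE e0; lra.
by move=> _ _; rewrite gt0_muley ?leey// lte_fin mulr_gt0 ?hardy_constant_gt0.
Qed.

Definition weighted_sqr x : \bar R := (u x ^+ 2 * psi (enorm x)^-1)%:E.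

Let weighted_sqr_ge0 x : (0 <= weighted_sqr x)%E.
Proof. by rewrite lee_fin mulr_ge0 ?sqr_ge0// psi_ge0. Qed.

Let measurable_weighted_sqr : measurable_fun setT weighted_sqr.
Proof.
apply/measurable_EFinP/measurable_funM; first exact: measurable_funX.
apply: (measurableT_comp (measurable_symbol nu nu_levy)).
rewrite (_ : (fun x => _) = (fun x => enorm x `^ (- 1))); last first.
  by apply/funext => x; rewrite powR_inv1// enorm_ge0.
exact: (measurableT_comp (@measurable_powR R (- 1)) measurable_enorm).
Qed.

(** On a shell 1/|x| is at most the inverse of the inner radius, so freezing the weight there costs
    only the factor clow^-1. The constant does not depend on s. *)
Lemma hardy_outside_cube s : 0 < s ->
  (\int[lebesgue R d.+1]_x (u x ^+ 2)%:E < +oo)%E ->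
  (\int[lebesgue R d.+1]_(x in ~` cube s) weighted_sqr x <=
   (clow^-1 * (2 * hardy_constant))%:E * energy)%E.
Proof.
move=> s0 uoo; have ci0 : 0 <= clow^-1 by rewrite invr_ge0 ltW.
rewrite EFinM -muleA.
apply: le_trans (lee_wpmul2l _ (sq_shell_sum_le s s0 uoo)); last by rewrite lee_fin.
rewrite -nneseriesZl; last by move=> n _; exact: sq_shell_ge0.
rewrite -shell_sum_integral//.
apply: lee_nneseries => [n _ _|n _]; first exact: integral_ge0.
have mS := @measurable_shell R d M s n.
rewrite /sq_shell muleA -EFinM -ge0_integralZl_EFin//; last 2 first.
- by apply: measurable_funTS; exact: measurable_sqr.
- by rewrite mulr_ge0// psi_ge0.
apply: ge0_le_integral => //.
- by apply: measurable_funTS; exact: measurable_weighted_sqr.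
- by apply: measurable_funeM; apply: measurable_funTS; exact: measurable_sqr.
move=> x xn; rewrite -EFinM lee_fin mulrC ler_wpM2r ?sqr_ge0//.
have rn := radius_gt0 M s M2 s0 n; have xr := shell_enorm_ge M s n x xn.
have x0 := lt_le_trans rn xr.
by rewrite symbol_almost_increasing ?invr_gt0// lef_pV2.
Qed.

(** Monotone convergence along s = 1/(n+1), with the bound uniform in s. *)
Lemma hardy_inequality :
  (\int[lebesgue R d.+1]_x (u x ^+ 2)%:E < +oo)%E ->
  (\int[lebesgue R d.+1]_x weighted_sqr x <=
   (clow^-1 * (2 * hardy_constant))%:E * energy)%E.
Proof.
move=> uoo; pose F (n : nat) : set (d.+1.-tuple R) := ~` cube n.+1%:R^-1.
have mF n : measurable (F n) by apply: measurableC; exact: measurable_cube.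
rewrite (_ : (\int[_]_x _ = \int[lebesgue R d.+1]_(x in \bigcup_n F n) weighted_sqr x)%E).
  have ndF : {homo F : m n / (m <= n)%N >-> (m <= n)%O}.
    move=> m n mn; rewrite subsetEset; apply: subsetC; apply: sub_cube.
    by rewrite lef_pV2 ?posrE// ler_nat.
  have cvgF := @ge0_nondecreasing_set_cvg_integral _ _ R F weighted_sqr
    (lebesgue R d.+1) ndF mF (fun=> measurable_funTS measurable_weighted_sqr)
    (fun _ x _ => weighted_sqr_ge0 x).
  rewrite -(cvg_lim (@ereal_hausdorff R) cvgF); apply: lime_le.
    by apply/cvg_ex; exists (\int[lebesgue R d.+1]_(x in \bigcup_n F n) weighted_sqr x)%E.
  by apply: nearW => n; exact: hardy_outside_cube.
(* The union of the F n misses only the origin, where the weight is psi(0) = 0. If |x| > 0, the n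
   chosen below has (d+1)/(n+1) < |x|, which puts x outside the cube of radius 1/(n+1). *)
rewrite [RHS]integral_mkcond; apply: eq_integral => x _; rewrite patchE.
case: ifPn => //; rewrite notin_setE /weighted_sqr => xF.
have -> : enorm x = 0.
  apply/eqP; rewrite eq_le enorm_ge0 andbT leNgt; apply/negP => x0; apply: xF.
  exists (Num.truncn (d.+1%:R / enorm x)) => // xc.
  have := enorm_le_cube _ _ xc; apply/negP; rewrite -ltNge.
  rewrite ltr_pdivrMr// -ltr_pdivrMl// mulrC; exact: truncnS_gt.
by rewrite invr0 symbol0// mulr0.
Qed.

End energy.

End hardy.

(** * Choice of the constants and comparison with [dirichlet_form] *)

Theorem corollary12 (R : realType) (d : nat) (nu : R -> R)
    (alow aup clow cup : R)
    (nu_levy : isotropic_unimodal_levy d nu)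
    (nu_infinite : infinite_levy d nu)
    (alow_gt0 : 0 < alow) (alow_le_aup : alow <= aup) (aup_lt2 : aup < 2)
    (clow_gt0 : 0 < clow) (clow_le1 : clow <= 1) (cup_ge1 : 1 <= cup)
    (psi_neq0 : exists xi : d.-tuple R, levy_symbol nu xi != 0)
    (psi_WLSC : WLSC alow clow (radial_profile (@levy_symbol R d nu)))
    (psi_WUSC : WUSC aup cup (radial_profile (@levy_symbol R d nu)))
    (aup_lt_d : aup < d%:R) :
  exists c : R, 0 < c /\
    forall u : d.-tuple R -> R, u \in Lfun (lebesgue R d) 2%:E ->
      (c%:E * \int[lebesgue R d]_x
          (u x ^+ 2 * radial_profile (@levy_symbol R d nu) (enorm x)^-1)%:E
        <= dirichlet_form nu u)%E.
Proof.
(* Dimension 0 contradicts 0 < alow <= aup < d. *)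
case: d => [|d] in nu_levy nu_infinite psi_neq0 psi_WLSC psi_WUSC aup_lt_d *.
  by move: (lt_le_trans alow_gt0 alow_le_aup); rewrite ltNge ltW.
have [c0 c0_gt0 density_ge] := density_lower_bound nu alow clow aup cup
  nu_levy alow_gt0 clow_gt0 cup_ge1 aup_lt2 psi_WLSC psi_WUSC.
have da_gt0 : 0 < d.+1%:R - aup by rewrite subr_gt0.
(* This M is the ratio of the shells, chosen independently of the one inside
   [density_lower_bound]. *)
have [M [M2 Mpow]] := powR_unbounded (d.+1%:R - aup) (4 * cup) da_gt0.
have MK := Mpow _ (lexx _).
pose H := clow^-1 * (2 * hardy_constant (d := d) aup cup M c0).
have H_gt0 : 0 < H by rewrite mulr_gt0 ?invr_gt0// mulr_gt0// hardy_constant_gt0.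
(* The 2 matches the factor 1/2 in [dirichlet_form]. *)
exists (2 * H)^-1; split; first by rewrite invr_gt0 mulr_gt0.
move=> u u2; have mu : measurable_fun setT u.
  by move: u2; rewrite inE => /andP[+ _]; rewrite inE.
have u2_lty : (\int[lebesgue R d.+1]_x (u x ^+ 2)%:E < +oo)%E.
  have /integrableP[_] := Lfun2_integrable_sqr u2.
  by under eq_integral do rewrite /= ger0_norm ?sqr_ge0//.
rewrite /dirichlet_form invfM EFinM -muleA lee_pmul2l//.
rewrite lee_pdivrMl//.
have hardy := (hardy_inequality nu alow clow aup cup nu_levy
  alow_gt0 clow_gt0 cup_ge1
  psi_WLSC psi_WUSC M c0 M2 MK c0_gt0 density_ge u mu u2_lty).
apply: (le_trans hardy).
rewrite -/H le_eqVlt; apply/orP; left; apply/eqP; congr (_ * _)%E.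
(* Normalizing the density at the origin affects only the diagonal x = y, where (u x - u y)^2
   vanishes. *)
apply: eq_integral => x _; apply: eq_integral => y _; rewrite /levy_density.
case: ifPn => // xy; have [->|/eqP/enorm_sub_gt0] := eqVneq x y; last first.
  by rewrite (negbTE xy).
by rewrite subrr expr0n/= !mul0r.
Qed.
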